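(* Let $G$ be a connected, triangle-free graph of order $n$ and minimum degree $\delta$, where $\delta\ge 3$ and $n\ge 6\delta$. Then $\rho(G)\le \rho(G(X_{n,\delta}))$.
   Context: For a connected graph $H$ of order $m\ge 2$ and vertex $v$, $\overline{\sigma}(v)=\frac{1}{m-1}\sum_{w\in V(H)} d(v,w)$; the remoteness is $\rho(H)=\max_v\overline{\sigma}(v)$. For a positive integer sequence $A=(a_1,a_2,\ldots)$ and nonnegative integer $p$, $\ell(A,p)$ is the smallest $k$ with $\sum_{i=1}^k a_i>p$. Let $A=(1,1,\delta-1,\delta-1,1,1,\delta-1,\delta-1,\ldots)$ repeat the block $(1,1,\delta-1,\delta-1)$ indefinitely. Then $X_{n,\delta}=(1,\delta,\delta-1,a_1,\ldots,a_\ell,\delta,r_{n,\delta})$ with $\ell=\ell(A,n-4\delta)$ and $r_{n,\delta}=n-3\delta-\sum_{i=1}^\ell a_i$. For a finite sequence $X=(x_0,\ldots,x_d)$ of positive integers, $G(X)$ is the graph whose vertex set is the disjoint union of independent sets $V_0,\ldots,V_d$ with $|V_i|=x_i$, in which every vertex of $V_i$ is adjacent to every vertex of $V_{i+1}$ for $0\le i<d$, and there are no other edges. *)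

(* Defs.v *)
From HB Require Import structures.
From mathcomp Require Import all_boot all_order all_algebra.

Set Implicit Arguments.
Unset Strict Implicit.
Unset Printing Implicit Defensive.

Import Order.TTheory GRing.Theory Num.Theory.

Record sgraph := SGraph {
  vertex :> finType;
  adj : rel vertex;
  adj_sym : symmetric adj;
  adj_irrefl : irreflexive adj
}.

Definition connected (G : sgraph) : Prop := forall x y : G, connect (@adj G) x y.

Definition triangle_free (G : sgraph) : Prop :=
  forall x y z : G, ~~ [&& adj x y, adj y z & adj z x].

Definition degree (G : sgraph) (x : G) : nat := #|[set y | adj x y]|.

(** Every degree is smaller than [#|G|], so for a nonempty graph the default
    value of the iterated minimum is never attained. *)
Definition min_degree (G : sgraph) : nat :=
  \big[minn/#|G|]_(x : G) degree x.

(** Least length of a walk from [x] to [y]; the junk value [#|G|] is returned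
    when [x] and [y] lie in different components. *)
Definition dist (G : sgraph) (x y : G) : nat :=
  find (fun k => [exists p : k.-tuple G, path (@adj G) x p && (last x p == y)])
       (iota 0 #|G|).

Definition avg_dist (G : sgraph) (v : G) : rat :=
  ((\sum_(w : G) dist v w)%N%:R / (#|G| - 1)%N%:R)%R.

(** Average distances are nonnegative, so the default value [0] is harmless. *)
Definition remoteness (G : sgraph) : rat :=
  \big[Order.max/0%R]_(v : G) avg_dist v.

Section LayeredGraph.
Variable X : seq nat.

(** The vertices with tag [i] form the independent set [V_i]. *)
Definition layer_vertex : finType := {i : 'I_(size X) & 'I_(nth 0 X i)}.

Definition layer_adj : rel layer_vertex := fun u v =>
  ((tag u).+1 == tag v :> nat) || ((tag v).+1 == tag u :> nat).

Lemma layer_adj_sym : symmetric layer_adj.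
Proof. by move=> u v; rewrite /layer_adj orbC. Qed.

Lemma layer_adj_irrefl : irreflexive layer_adj.
Proof. by move=> u; rewrite /layer_adj orbb gtn_eqF. Qed.

Definition layered_graph : sgraph := SGraph layer_adj_sym layer_adj_irrefl.

End LayeredGraph.

(** Infinite sequences are indexed from 0: [A i] is the term a_(i+1).
    For a sequence of positive integers the first [p.+1] terms already sum to
    more than [p], so the search up to [p.+1] always succeeds. *)
Definition ell (A : nat -> nat) (p : nat) : nat :=
  find (fun k => p < \sum_(0 <= i < k) A i) (iota 0 p.+2).

Definition seqA (delta i : nat) : nat :=
  nth 0 [:: 1; 1; delta - 1; delta - 1] (i %% 4).

Definition ellX (n delta : nat) : nat := ell (seqA delta) (n - 4 * delta).

(** When [2 <= delta] and [4 * delta <= n] the subtractions do not truncate and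
    the result lies between 1 and [delta - 1]. *)
Definition rX (n delta : nat) : nat :=
  n - 3 * delta - \sum_(0 <= i < ellX n delta) seqA delta i.

Definition seqX (n delta : nat) : seq nat :=
  [:: 1; delta; delta - 1] ++ mkseq (seqA delta) (ellX n delta)
    ++ [:: delta; rX n delta].

(* Main.v *)
(** Fix a vertex [v] of eccentricity [e] and let [S j] be the number of vertices
    at distance at most [j] from [v], so that the total distance of [v] is the
    sum of [n - S j] over [j < e].  In a triangle-free graph the two ends of an
    edge have at least [2 * delta] neighbours altogether; applied to an edge
    between consecutive distance levels this gives [S (j + 4) >= S j + 2 * delta],
    hence [S j >= B j] for [j <= e], where [B] is the sequence of partial sums of
    [1, delta, delta - 1, a_1, a_2, ...].  At the far end, [S (e - 3)] is at most
    [n - 2 * delta], which forces [e <= ell + 4]; and if [e = ell + 4] then the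
    last level is independent, so the level before it has at least [delta]
    vertices.  The resulting bound is the total distance of the vertex of [V_0]
    in the extremal layered graph. *)
Require Import Defs.
From mathcomp Require Import all_boot all_order all_algebra.
From mathcomp Require Import zify.

Set Implicit Arguments.
Unset Strict Implicit.
Unset Printing Implicit Defensive.

(** * Minimum degree, distances and neighbourhoods of edges *)

Lemma min_degree_le (G : sgraph) (x : G) : min_degree G <= degree x.
Proof.
rewrite /min_degree; have := mem_index_enum x.
elim: (index_enum _) => [//|y s IHs]; rewrite inE big_cons => /orP[/eqP <-|/IHs].
  exact: geq_minl.
by apply: leq_trans; apply: geq_minr.
Qed.

Lemma dist_le_size (G : sgraph) (x : G) (p : seq G) :
  path (@adj G) x p -> dist x (last x p) <= size p.
Proof.
move=> xp; rewrite /dist; have [lep|ltp] := leqP #|G| (size p).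
  by apply: leq_trans lep; rewrite -[leqRHS](size_iota 0) find_size.
rewrite leqNgt; apply/negP => /(before_find 0) /existsP[].
rewrite nth_iota // add0n; exists (in_tuple p).
by rewrite xp eqxx.
Qed.

Lemma dist_path (G : sgraph) (x y : G) : dist x y < #|G| ->
  exists p, [/\ path (@adj G) x p, last x p = y & size p = dist x y].
Proof.
rewrite /dist => ltG.
have := ltG; rewrite -[X in _ < X](size_iota 0) -has_find => /(nth_find 0).
rewrite nth_iota // add0n => /existsP[p /andP[xp /eqP lp]].
by exists p; rewrite size_tuple.
Qed.

(** A path without repeated vertices has fewer than [#|G|] edges, so in a connected graph the junk
    value of [dist] never occurs. *)
Lemma connected_dist_lt (G : sgraph) (x y : G) :
  connected G -> dist x y < #|G|.
Proof.
move=> /(_ x y) /connectP[p xp ->].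
case: (shortenP xp) => q xq uq _.
apply: leq_ltn_trans (dist_le_size xq) _.
by have := max_card (mem (x :: q)); rewrite (card_uniqP uq).
Qed.

Lemma distxx (G : sgraph) (x : G) : dist x x = 0.
Proof. by apply/eqP; rewrite -leqn0 (@dist_le_size _ _ [::]). Qed.

Lemma dist_adj (G : sgraph) (v x y : G) :
  connected G -> adj x y -> dist v y <= (dist v x).+1.
Proof.
move=> cG xy; have [p [vp lp <-]] := dist_path (connected_dist_lt v x cG).
have := @dist_le_size G v (rcons p y).
by rewrite last_rcons size_rcons rcons_path vp lp => ->.
Qed.

Lemma dist_pred (G : sgraph) (v w : G) k :
  connected G -> dist v w = k.+1 -> exists2 u, adj u w & dist v u = k.
Proof.
move=> cG dw; have [p [vp lp]] := dist_path (connected_dist_lt v w cG).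
rewrite dw; case: (lastP p) vp lp => [//|q z].
rewrite rcons_path last_rcons size_rcons => /andP[vq qz] zw [szq].
rewrite zw in qz; exists (last v q) => //.
by have := dist_le_size vq; have := dist_adj v cG qz; lia.
Qed.

Lemma dist_surj (G : sgraph) (v w : G) k :
  connected G -> k <= dist v w -> exists u, dist v u = k.
Proof.
move=> cG; move: {2}(dist v w) (erefl (dist v w)) => m.
elim: m w => [|m IHm] w dw.
  by rewrite dw leqn0 => /eqP ->; exists w.
rewrite leq_eqVlt => /orP[/eqP ->|]; first by exists w.
by rewrite dw; have [u _ du] := dist_pred cG dw; rewrite ltnS -du; apply: IHm.
Qed.

(* In a triangle-free graph the ends of an edge have disjoint neighbourhoods. *)
Lemma card_edge_nbhd (G : sgraph) (u w : G) (A B : {set G}) :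
    triangle_free G -> adj u w ->
    (forall z, adj u z || adj w z -> z \in B :\: A) -> A \subset B ->
  #|A| + 2 * min_degree G <= #|B|.
Proof.
move=> tG uw sB sAB; have := min_degree_le u; have := min_degree_le w.
rewrite /degree => leu lew.
have dis : [disjoint [set y | adj u y] & [set y | adj w y]].
  apply/pred0P => z; apply/negP; rewrite /= !inE => /andP[uz wz].
  by have := tG u w z; rewrite uw wz adj_sym uz.
have := leq_card_setU [set y | adj u y] [set y | adj w y].
rewrite dis => -[_ /eqP cU].
have : [set y | adj u y] :|: [set y | adj w y] \subset B :\: A.
  by apply/subsetP => z; rewrite !in_setU !in_set => /sB; rewrite in_setD.
move/subset_leq_card; rewrite cU cardsD (setIidPr sAB).
by have := subset_leq_card sAB; lia.
Qed.

(** * Growth of the balls around a fixed vertex *)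

Section DistanceBalls.
Variables (G : sgraph) (v : G).
Hypotheses (cG : connected G) (tG : triangle_free G).
Let delta := min_degree G.

Definition ball j := [set w | dist v w <= j].

Definition ecc := \max_(w : G) dist v w.

Lemma dist_le_ecc w : dist v w <= ecc.
Proof. exact: (leq_bigmax w). Qed.

Lemma ecc_attained : exists w, dist v w = ecc.
Proof.
have G0 : 0 < #|G| by apply/card_gt0P; exists v.
by have [w dw] := eq_bigmax (@dist G v) G0; exists w; rewrite /ecc dw.
Qed.

Lemma level_edge k : k < ecc ->
  exists u w, [/\ adj u w, dist v u = k & dist v w = k.+1].
Proof.
have [z <-] := ecc_attained => /(dist_surj cG)[w dw].
by have [u uw du] := dist_pred cG dw; exists u, w.
Qed.

Lemma ball_subset i j : i <= j -> ball i \subset ball j.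
Proof.
by move=> leij; apply/subsetP => w; rewrite !inE => /leq_trans; apply.
Qed.

Lemma dist_nbhd x z : adj x z ->
  dist v z <= (dist v x).+1 /\ dist v x <= (dist v z).+1.
Proof.
by move=> xz; split; apply: dist_adj => //; rewrite adj_sym.
Qed.

Lemma ball0_card : 0 < #|ball 0|.
Proof. by apply/card_gt0P; exists v; rewrite inE distxx. Qed.

Lemma ball1_card : delta < #|ball 1|.
Proof.
apply: leq_ltn_trans (min_degree_le v) _.
have sB : v |: [set y | adj v y] \subset ball 1.
  apply/subsetP => z; rewrite !inE => /orP[/eqP ->|/dist_nbhd[]].
    by rewrite distxx.
  by rewrite distxx.
by have := subset_leq_card sB; rewrite cardsU1 inE adj_irrefl.
Qed.

Lemma ball2_card : 0 < ecc -> 2 * delta <= #|ball 2|.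
Proof.
move=> /level_edge[u [w [uw du dw]]].
apply: leq_trans (card_edge_nbhd (A := set0) tG uw _ (sub0set _)).
  by rewrite cards0.
by move=> z; rewrite !inE => /orP[] /dist_nbhd; lia.
Qed.

Lemma ballS_card j : j < ecc -> #|ball j| < #|ball j.+1|.
Proof.
move=> /level_edge[_ [w [_ _ dw]]].
apply: proper_card; apply/properP; split; first exact: ball_subset.
by exists w; rewrite inE dw // ltnn.
Qed.

(** An edge between levels [j.+2] and [j.+3] has all its neighbours in levels [j.+1] to [j.+4]. *)
Lemma ball4_card j : j.+2 < ecc -> #|ball j| + 2 * delta <= #|ball j.+4|.
Proof.
move=> /level_edge[u [w [uw du dw]]].
apply: (card_edge_nbhd tG uw); last by apply: ball_subset; lia.
by move=> z; rewrite !inE => /orP[] /dist_nbhd; lia.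
Qed.

Lemma ball_ecc3_card j : j.+3 = ecc -> #|ball j| + 2 * delta <= #|G|.
Proof.
move=> je; have /level_edge[u [w [uw du dw]]] : j.+2 < ecc by rewrite -je.
rewrite -cardsT; apply: (card_edge_nbhd tG uw); last exact: subsetT.
by move=> z; rewrite !inE => /orP[] /dist_nbhd; lia.
Qed.

(* Either the last level spans an edge, or it is independent and then the
   neighbours of any of its vertices all lie in the previous level. *)
Lemma ball_ecc2_card j : j.+2 = ecc ->
  #|ball j| + 2 * delta <= #|G| \/ #|ball j| + delta <= #|ball j.+1|.
Proof.
move=> je; have [w dw] := ecc_attained.
case: (pickP (fun u => adj w u && (dist v u == ecc))) => [u|indep].
  move=> /andP[wu /eqP du]; left; rewrite -cardsT.
  apply: (card_edge_nbhd tG wu); last exact: subsetT.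
  by move=> z; rewrite !inE => /orP[] /dist_nbhd; lia.
right; have := min_degree_le w; rewrite -/delta /degree => degw.
apply: leq_trans (_ : #|ball j :|: [set y | adj w y]| <= _).
  have := leq_card_setU (ball j) [set y | adj w y].
  have -> : [disjoint ball j & [set y | adj w y]].
    apply/pred0P => z; apply/negP; rewrite /= !inE => /andP[dz /dist_nbhd].
    by lia.
  by move=> [_ /eqP ->]; rewrite leq_add2l.
apply/subset_leq_card/subsetP => z; rewrite !inE => /orP[/leqW //|wz].
have := indep z; rewrite wz /= => /eqP/eqP; have := dist_le_ecc z; lia.
Qed.

(** Double counting: [dist v w] is the number of radii [j] whose ball misses [w]. *)
Lemma sum_dist : \sum_(w : G) dist v w = \sum_(j < ecc) (#|G| - #|ball j|).
Proof.
transitivity (\sum_(w : G) \sum_(j < ecc) (j < dist v w : nat)).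
  (* Replacing the distance by its minimum with [ecc] gives an identity valid for every [k], which
     allows induction on the bound. *)
  apply: eq_bigr => w _; rewrite -[LHS](minn_idPr (dist_le_ecc w)).
  elim: ecc (dist v w) => [|m IHm] k; first by rewrite min0n big_ord0.
  by rewrite big_ord_recr /= -IHm; lia.
rewrite exchange_big; apply: eq_bigr => j _.
rewrite -(cardsC (ball j)) addKn -sum1_card [RHS]big_mkcond.
by apply: eq_bigr => w _; rewrite !inE -ltnNge; case: ltnP.
Qed.

End DistanceBalls.

(** * The extremal sequence and its partial sums *)

Lemma seqA_bounds delta i : 3 <= delta -> 0 < seqA delta i < delta.
Proof.
move=> d3; rewrite /seqA; have: i %% 4 < 4 by rewrite ltn_mod.
by case: (i %% 4) => [|[|[|[|]]]] //=; lia.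
Qed.

(** The first [k] terms sum to at least [k], so the search succeeds; the empty sum never exceeds
    [p], so the result is a successor. *)
Lemma ell_spec (A : nat -> nat) p : (forall i, 0 < A i) ->
  exists k, [/\ ell A p = k.+1, p < \sum_(0 <= i < k.+1) A i
    & \sum_(0 <= i < k) A i <= p].
Proof.
move=> A0; pose P k := p < \sum_(0 <= i < k) A i.
have geA k : k <= \sum_(0 <= i < k) A i.
  elim: k => [//|k IHk]; rewrite big_nat_recr //=; have := A0 k; lia.
have hasP : has P (iota 0 p.+2).
  by apply/hasP; exists p.+1; [rewrite mem_iota; lia | apply: geA].
have := nth_find 0 hasP; have := hasP.
have := @before_find _ 0 P (iota 0 p.+2).
rewrite has_find size_iota -/(ell A p) /P => before lt_ell.
rewrite nth_iota // add0n.
case def_k : (ell A p) lt_ell => [|k] lt_ell Pk; first by rewrite big_geq in Pk.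
exists k; split=> //; rewrite leqNgt; apply/negbT.
have := before k; rewrite -/(ell A p) def_k nth_iota; last lia.
by apply.
Qed.

(** The layer sizes of [seqX] without the last two, continued indefinitely. *)
Definition seqC delta i :=
  if i < 3 then nth 0 [:: 1; delta; delta - 1] i else seqA delta (i - 3).

(** The period starts at index 2, since the prefix entry [delta - 1] there fits the pattern of
    [seqA]. *)
Lemma seqC_periodic delta i : seqC delta i.+2.+4 = seqC delta i.+2.
Proof.
case: i => [//|i]; rewrite /seqC /seqA /= !subSS !subn0.
by rewrite -addn4 modnDr.
Qed.

(** The lower bound [B j] for balls; there are [j.+1] terms because a ball of radius [j] covers
    levels 0 to [j]. *)
Definition psumC delta j := \sum_(0 <= i < j.+1) seqC delta i.

Lemma psumCS delta j : psumC delta j.+1 = psumC delta j + seqC delta j.+1.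
Proof. by rewrite /psumC big_nat_recr. Qed.

Lemma psumC0 delta : psumC delta 0 = 1.
Proof. by rewrite /psumC big_nat1. Qed.

Lemma psumC_periodic delta j : 0 < delta ->
  psumC delta j.+1.+4 = psumC delta j.+1 + 2 * delta.
Proof.
move=> d0; elim: j => [|j IHj]; first by rewrite !psumCS psumC0 /seqC /seqA /=; lia.
by rewrite psumCS IHj [in RHS]psumCS seqC_periodic; lia.
Qed.

Lemma psumC_seqA delta k : 0 < delta ->
  psumC delta k.+2 = 2 * delta + \sum_(0 <= i < k) seqA delta i.
Proof.
move=> d0; elim: k => [|k IHk].
  by rewrite !psumCS psumC0 big_geq // /seqC /=; lia.
by rewrite psumCS IHk big_nat_recr //= /seqC /= !subSS subn0; lia.
Qed.

Lemma psumC_mono delta i j : i <= j -> psumC delta i <= psumC delta j.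
Proof.
move=> /subnK <-; elim: (j - i) => [//|k IHk].
by rewrite addSn psumCS; lia.
Qed.

Lemma ltn_psumC delta j : 3 <= delta -> j < psumC delta j.
Proof.
move=> d3; elim: j => [|j IHj]; first by rewrite psumC0.
suff: 0 < seqC delta j.+1 by rewrite psumCS; lia.
rewrite /seqC; case: ifP => [|_]; last by case/andP: (seqA_bounds (j.+1 - 3) d3).
by case: j {IHj} => [|[|]] //=; lia.
Qed.

Lemma psumC_le_ball (G : sgraph) (v : G) j :
    connected G -> triangle_free G -> 0 < min_degree G -> j <= ecc v ->
  psumC (min_degree G) j <= #|ball v j|.
Proof.
move=> cG tG d0; elim/ltn_ind: j => j.
have b0 := ball0_card v; have b1 := ball1_card v cG.
have b2 := @ball2_card G v cG tG; have bS := @ballS_card G v cG.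
(* The bounds 1, [delta + 1], [2 * delta], [2 * delta + 1], [2 * delta + 2] are checked directly, as
   the recurrence for [psumC] starts only at index 1. *)
case: j => [|[|[|[|[|j]]]]] IHj lej.
- by rewrite psumC0.
- by rewrite psumCS psumC0 /seqC /=.
- by rewrite !psumCS psumC0 /seqC /=; have := b2; lia.
- have := bS 2 lej; have := b2; rewrite !psumCS psumC0 /seqC /seqA /=; lia.
- have := bS 2; have := bS 3 lej; have := b2.
  by rewrite !psumCS psumC0 /seqC /seqA /=; lia.
rewrite psumC_periodic //; apply: leq_trans (ball4_card cG tG _); last lia.
by rewrite leq_add2r IHj //; lia.
Qed.

(** Summation by parts, turning a sum of layer indices into a sum of partial sums. *)
Lemma sum_index_seqC delta m :
  \sum_(0 <= i < m) i * seqC delta i + \sum_(0 <= j < m) psumC delta j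
  = m * \sum_(0 <= i < m) seqC delta i.
Proof.
elim: m => [|m IHm]; first by rewrite !big_geq.
have psum_m : psumC delta m = \sum_(0 <= i < m) seqC delta i + seqC delta m.
  by rewrite /psumC big_nat_recr.
by rewrite !big_nat_recr //= psum_m; nia.
Qed.

Lemma nth_seqX n delta i : i < (ellX n delta).+3 ->
  nth 0 (seqX n delta) i = seqC delta i.
Proof.
case: i => [|[|[|i]]] //= lti; rewrite /seqC /= !subSS subn0.
by have lt_i : i < ellX n delta by []; rewrite nth_cat size_mkseq lt_i nth_mkseq.
Qed.

Lemma size_seqX n delta : size (seqX n delta) = ellX n delta + 5.
Proof. by rewrite /= size_cat size_mkseq /=; lia. Qed.

Lemma sum_seqX (F : nat -> nat -> nat) n delta :
  \sum_(0 <= i < size (seqX n delta)) F i (nth 0 (seqX n delta) i)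
  = \sum_(0 <= i < (ellX n delta).+3) F i (seqC delta i)
    + F (ellX n delta).+3 delta + F (ellX n delta).+4 (rX n delta).
Proof.
rewrite size_seqX addnC /= big_nat_recr //= big_nat_recr //=.
rewrite !nth_cat size_mkseq ltnn subnn /= [_ < _]ltnNge leqnSn /= subSnn /=.
by congr (_ + _ + _); apply: eq_big_nat => i /andP[_ /nth_seqX ->].
Qed.

(** * Distances from the first layer of a layered graph *)

Section LayeredGraphDistance.
Variable X : seq nat.

Lemma sum_layer_tag (F : nat -> nat) :
  \sum_(w : layered_graph X) F (tag w) = \sum_(0 <= i < size X) F i * nth 0 X i.
Proof.
rewrite big_mkord.
transitivity (\sum_(i < size X) \sum_(j < nth 0 X i) F i).
  rewrite (@sig_big_dep _ _ _ _ (fun i : 'I_(size X) => 'I_(nth 0 X i))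
    xpredT (fun _ => xpredT) (fun (i : 'I_(size X)) _ => F i)).
  by apply: eq_bigl.
by apply: eq_bigr => i _; rewrite sum_nat_const card_ord mulnC.
Qed.

Lemma layered_path_tag (u : layered_graph X) (p : seq (layered_graph X)) :
  path (@adj (layered_graph X)) u p -> tag (last u p) <= tag u + size p.
Proof.
elim: p u => [|w p IHp] u /=; first by rewrite addn0.
case/andP => uw /IHp le_w; apply: leq_trans le_w _; rewrite addnS -addSn leq_add2r.
by case/orP: uw => /eqP <-; rewrite // -addn2 leq_addr.
Qed.

(** Each edge raises the tag by at most one; the bound on [size X] covers the junk value of
    [dist]. *)
Lemma layered_dist_tag (u w : layered_graph X) :
  size X <= #|layered_graph X| -> tag u = 0 :> nat -> tag w <= dist u w.
Proof.
move=> leX u0; have [|] := ltnP (dist u w) #|layered_graph X|.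
  by case/dist_path => p [/layered_path_tag up <- <-]; rewrite u0 in up.
move=> /(leq_trans leX); apply: leq_trans; exact: ltnW (ltn_ord (tag w)).
Qed.

End LayeredGraphDistance.

(** * Comparison of total distances *)

Import Order.TTheory GRing.Theory Num.Theory.

Theorem theorem3p4 (G : sgraph) (n delta : nat) :
  connected G -> triangle_free G -> #|G| = n -> min_degree G = delta ->
  3 <= delta -> 6 * delta <= n ->
  (remoteness G <= remoteness (layered_graph (seqX n delta)))%R.
Proof.
move=> cG tG cardG mdG d3 n6.
have [k [def_ell gt_k le_k]] :=
  @ell_spec (seqA delta) (n - 4 * delta) (fun i => proj1 (andP (seqA_bounds i d3))).
rewrite -/(ellX n delta) in def_ell.
have psum_ell := @psumC_seqA delta (ellX n delta) ltac:(lia).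
have psum_k := @psumC_seqA delta k ltac:(lia).
(* By [le_k] and [seqA delta k < delta], the subtractions in [rX] do not truncate and leave a
   positive number. *)
have def_r : psumC delta (ellX n delta).+2 + delta + rX n delta = n /\ 0 < rX n delta.
  have := seqA_bounds k d3; rewrite psum_ell /rX def_ell big_nat_recr //=.
  by lia.
rewrite def_ell in psum_ell.
have cardX : #|layered_graph (seqX n delta)| = n.
  transitivity (\sum_(0 <= i < size (seqX n delta)) 1 * nth 0 (seqX n delta) i).
    by rewrite -sum1_card -(sum_layer_tag _ (fun _ => 1)); apply: eq_bigl.
  rewrite (sum_seqX (fun _ x => 1 * x)) !mul1n; under eq_bigr do rewrite mul1n.
  exact: def_r.1.
(* The separate [rX] is the term of index [(ellX n delta).+3]: only the last layer lies beyond
   it. *)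
have sumX : \sum_(w : layered_graph (seqX n delta)) (tag w : nat) =
    \sum_(j < (ellX n delta).+3) (n - psumC delta j) + rX n delta.
  rewrite (sum_layer_tag _ id) (sum_seqX muln).
  rewrite sumnB; last first.
    by move=> j _; have := @psumC_mono delta j (ellX n delta).+2; have := ltn_ord j; lia.
  rewrite sum_nat_const card_ord.
  have := sum_index_seqC delta (ellX n delta).+3.
  rewrite -/(psumC delta (ellX n delta).+2) (big_mkord xpredT (psumC delta)).
  have := congr1 (muln (ellX n delta).+3) def_r.1; rewrite !mulnDr => <- <-.
  by rewrite [_.+4 * _]mulSn; move: (\sum_(i < _) _) (\sum_(0 <= i < _) _) => ? ?; lia.
have sum_le v : \sum_(w : G) dist v w <=
    \sum_(j < (ellX n delta).+3) (n - psumC delta j) + rX n delta.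
  rewrite (sum_dist v) cardG.
  have leB j := @psumC_le_ball G v j cG tG.
  rewrite mdG in leB.
  have head m : m <= ecc v -> m <= (ellX n delta).+3 ->
      \sum_(j < m) (n - #|ball v j|) <= \sum_(j < (ellX n delta).+3) (n - psumC delta j).
    move=> lee lel; rewrite -(big_mkord xpredT (fun j => n - #|ball v j|)).
    rewrite -(big_mkord xpredT (fun j => n - psumC delta j)).
    rewrite (big_cat_nat _ lel) //=; apply: leq_trans (leq_addr _ _).
    rewrite big_nat [leqRHS]big_nat; apply: leq_sum => j /andP[_ ltj].
    by have := leB j; lia.
  have [le_e|gt_e] := leqP (ecc v) (ellX n delta).+3.
    by apply: leq_trans (head _ (leqnn _) le_e) (leq_addr _ _).
  have [j ej] : exists j, j.+3 = ecc v by exists (ecc v - 3); lia.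
  have := ball_ecc3_card cG tG ej; have := leB j; rewrite mdG cardG => leBj le_n.
  (* By [gt_k], [psumC delta k.+3] exceeds [n - 2 * delta], which [le_n] forbids for the ball of
     radius [j]. *)
  have jk : j = k.+2.
    have : k.+3 <= j -> psumC delta k.+3 <= psumC delta j by apply: psumC_mono.
    by lia.
  rewrite -ej big_ord_recr /=; apply: leq_add; first by apply: head; lia.
  (* The first alternative again contradicts [gt_k]; the second bounds the final term by
     [n - psumC delta k.+3 - delta], which is [rX n delta]. *)
  have := ball_ecc2_card cG tG ej; have := leB j.+1; rewrite mdG cardG.
  rewrite jk -def_ell; have := def_r.1; rewrite def_ell; lia.
have [u u0] : exists u : layered_graph (seqX n delta), tag u = 0 :> nat.
  have lt0 : 0 < size (seqX n delta) by [].
  by exists (Tagged (fun i : 'I_(size (seqX n delta)) => 'I_(nth 0 (seqX n delta) i))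
    (i := Ordinal lt0) (@Ordinal 1 0 isT)).
have size_le : size (seqX n delta) <= #|layered_graph (seqX n delta)|.
  rewrite cardX size_seqX; have := ltn_psumC (ellX n delta).+2 d3.
  by have := def_r; lia.
have dist_ge (v : G) : (avg_dist v <= avg_dist u)%R.
  rewrite /avg_dist cardX cardG ler_wpM2r ?invr_ge0 ?ler0n // ler_nat.
  apply: leq_trans (sum_le v) _; rewrite -sumX.
  by apply: leq_sum => w _; apply: layered_dist_tag.
apply/bigmax_leP; split=> [|v _]; last first.
  exact: le_trans (dist_ge v) (le_bigmax _ _ u).
by apply: le_trans (le_bigmax _ _ u); rewrite /avg_dist divr_ge0 ?ler0n.
Qed.
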